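(* There is a universal constant $C>0$ with the following property. Suppose that $\mathfrak d$ is a separation profile of a locally compact metric space $(\mathcal M,d_{\mathcal M})$. For every Banach space $(\mathbf Z,\|\cdot\|_{\mathbf Z})$ and every subset $\mathscr C\subseteq\mathcal M$, if $f:\mathscr C\to\mathbf Z$ satisfies $\|f(x)-f(y)\|_{\mathbf Z}\le d_{\mathcal M}(x,y)$ for every $x,y\in\mathscr C$, then there is $F:\mathcal M\to\mathbf Z$ that extends $f$ and satisfies $\|F(x)-F(y)\|_{\mathbf Z}\le C\,\mathfrak d(x,y)$ for every $x,y\in\mathcal M$.
   Context: Vector spaces are real. A random partition $\mathscr P$ of a metric space $(\mathcal M,d_{\mathcal M})$ consists of a probability space $(\Omega,\mathbf{Prob})$ and set-valued mappings $\Gamma^k:\Omega\to2^{\mathcal M}$, $k\in\mathbb N$, such that $\mathscr P^\omega=\{\Gamma^k(\omega)\}_{k=1}^\infty$ is a partition of $\mathcal M$ for every $\omega\in\Omega$ (empty clusters are allowed) and each $\Gamma^k$ is strongly measurable, i.e., $\{\omega:\ E\cap\Gamma^k(\omega)\neq\emptyset\}$ is $\mathbf{Prob}$-measurable for every closed $E\subseteq\mathcal M$. $\mathscr P(x)$ denotes the cluster containing $x$. $\mathscr P$ is $\Delta$-bounded if every cluster of $\mathscr P^\omega$ has $d_{\mathcal M}$-diameter at most $\Delta$, for every $\omega$. A metric $\mathfrak d:\mathcal M\times\mathcal M\to[0,\infty)$ is a separation profile of $(\mathcal M,d_{\mathcal M})$ if for every $\Delta>0$ there is a $\Delta$-bounded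 random partition $\mathscr P_\Delta$ of $(\mathcal M,d_{\mathcal M})$, defined on some probability space $(\Omega_\Delta,\mathbf{Prob}_\Delta)$, such that $$\forall x,y\in\mathcal M,\qquad\mathfrak d(x,y)\ge\sup_{\Delta\in(0,\infty)}\Delta\,\mathbf{Prob}_\Delta\big[\mathscr P_\Delta(x)\ne\mathscr P_\Delta(y)\big].$$ *)

(* Defs.v *)
From HB Require Import structures.
From mathcomp Require Import all_boot all_order all_algebra.
From mathcomp Require Import all_classical all_reals all_analysis.

Set Implicit Arguments.
Unset Strict Implicit.
Unset Printing Implicit Defensive.

Import Order.TTheory GRing.Theory Num.Theory.
Import numFieldNormedType.Exports.

Local Open Scope classical_set_scope.
Local Open Scope ring_scope.

(* The clusters form a pairwise disjoint family indexed by nat, in which empty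
   members may occur.  Measurability is with respect to the sigma-algebra on
   [rp_space], which is not required to be complete for [rp_prob]. *)
Record random_partition (R : realType) (M : metricType R) := RandomPartition {
  rp_display : measure_display ;
  rp_space : measurableType rp_display ;
  rp_prob : probability rp_space R ;
  rp_cluster : nat -> rp_space -> set M ;
  rp_cover : forall w, \bigcup_k rp_cluster k w = [set: M] ;
  rp_disjoint : forall w, trivIset [set: nat] (fun k => rp_cluster k w) ;
  rp_measurable : forall (k : nat) (E : set M), closed E ->
    measurable [set w | E `&` rp_cluster k w !=set0]
}.

(* Exactly one index contributes to the union. *)
Definition cluster_of (R : realType) (M : metricType R)
    (P : random_partition M) (w : rp_space P) (x : M) : set M :=
  \bigcup_(k in [set k | rp_cluster k w x]) rp_cluster k w.

(* The diameter of the empty set is -oo, so empty clusters are harmless in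
   [bounded_partition]. *)
Definition diameter (R : realType) (M : metricType R) (A : set M) : \bar R :=
  ereal_sup [set (mdist p.1 p.2)%:E | p in A `*` A].

Definition bounded_partition (R : realType) (M : metricType R)
    (Delta : R) (P : random_partition M) : Prop :=
  forall (w : rp_space P) (k : nat),
    (diameter (rp_cluster k w) <= Delta%:E)%E.

Definition separation_prob (R : realType) (M : metricType R)
    (P : random_partition M) (x y : M) : \bar R :=
  rp_prob P [set w | cluster_of w x <> cluster_of w y].

Definition is_metric (R : realType) (T : Type) (d : T -> T -> R) : Prop :=
  [/\ forall x y, 0 <= d x y,
      forall x y, d x y = 0 <-> x = y,
      forall x y, d x y = d y x &
      forall x y z, d x z <= d x y + d y z].

Definition separation_profile (R : realType) (M : metricType R)
    (sep : M -> M -> R) : Prop :=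
  is_metric sep /\
  exists P : {posnum R} -> random_partition M,
    (forall Delta : {posnum R}, bounded_partition Delta%:num (P Delta)) /\
    forall x y : M,
      (ereal_sup (range (fun Delta : {posnum R} =>
         Delta%:num%:E * separation_prob (P Delta) x y)) <= (sep x y)%:E)%E.

(* Main.v *)
Require Import Defs.
From mathcomp Require Import all_boot all_order all_algebra.
From mathcomp Require Import all_classical all_reals all_analysis.
From mathcomp Require Import ring lra zify.

(** Let [f] be 1-Lipschitz on a subset of [M] and let [D x] be the distance from
    [x] to that subset.  At a fixed scale [Delta], a [Delta]-bounded random
    partition extends [f] approximately: assign to every cluster a point of the
    domain that is nearly nearest to it, and let [G Delta x] be the expected value
    of [f] at the point assigned to the cluster of [x].  All the points that
    matter for [x] lie within [O(D x + Delta)] of [x], so [G Delta x] is as close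
    to the values of [f]; and [G Delta x] and [G Delta y] differ only on the event
    that [x] and [y] are separated, whose probability is at most [sep x y / Delta].
    Hence [G Delta] is [O(1)]-Lipschitz with respect to [sep] at the points with
    [D x = O(Delta)].  This is [single_scale_extension].

    The point assigned to a cluster has to depend measurably on the outcome, and
    the expectation has to make sense in an arbitrary Banach space.  Both are
    achieved by using countably many points only.  For each index [k], a countable
    family of balls of radius [Delta] is chosen such that the probability that the
    [k]-th cluster meets one of them is maximal ([countable_exhaustion]).  By
    maximality, for every fixed [x], the cluster of [x] almost surely meets a ball
    of the family with its own index, because otherwise adding the ball around [x]
    would increase the probability.  Going through all pairs (index, ball) in one
    sequence, a point [x] is captured by the first pair whose index is that of the
    cluster of [x] and whose ball meets this cluster.  The events that [x] is
    captured at step [j] are disjoint and cover almost everything, the pair that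
    captures [x] depends only on the cluster of [x], and the expectation is the
    sum of a series, with coefficients the probabilities of these events.

    The scales are then combined ([glue_scales]): at a point with [D x > 0] the
    extension interpolates linearly in [D x] between [G a] and [G (2 a)], where [a]
    is the power of 2 such that [a <= D x < 2 a].  If [x] and [y] are close compared
    with [D x], both the functions [G a] and the interpolation parameter vary
    slowly enough; if they are not, the values at [x] and [y] are compared with the
    value of [f] at a point nearly nearest to [x].  Bounds in terms of the metric
    suffice here, since [sep] dominates it ([mdist_le_separation]): points at
    distance more than [Delta] always lie in different clusters.  Where [D x = 0]
    the value is a limit of values of [f], by completeness. *)

Import Order.TTheory GRing.Theory Num.Theory.
Import numFieldNormedType.Exports.
Local Open Scope classical_set_scope.
Local Open Scope ring_scope.

Set Implicit Arguments.
Unset Strict Implicit.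

(** * Real-valued probabilities and countable exhaustion *)

Definition pr {d} {T : measurableType d} {R : realType}
  (P : probability T R) (A : set T) : R := fine (P A).

Section Probability.
Context {d : measure_display} {T : measurableType d} {R : realType}.
Variable P : probability T R.
Implicit Types A B : set T.

Lemma prE A : measurable A -> (pr P A)%:E = P A.
Proof. by move=> mA; rewrite fineK// fin_num_measure. Qed.

Lemma pr_ge0 A : 0 <= pr P A.
Proof. exact/fine_ge0/measure_ge0. Qed.

Lemma le_pr A B : measurable A -> measurable B -> A `<=` B -> pr P A <= pr P B.
Proof.
by move=> mA mB AB; rewrite -lee_fin !prE//; apply: le_measure; rewrite ?inE.
Qed.

Lemma pr_le1 A : measurable A -> pr P A <= 1.
Proof. by move=> mA; rewrite -lee_fin prE// probability_le1. Qed.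

Lemma prDI A B : measurable A -> measurable B ->
  pr P A = pr P (A `\` B) + pr P (A `&` B).
Proof.
move=> mA mB; apply: EFin_inj; rewrite EFinD !prE//.
- exact: measureDI.
- exact: measurableI.
- exact: measurableD.
Qed.

Lemma cvg_series_pr (D : nat -> set T) :
  (forall j, measurable (D j)) -> trivIset setT D ->
  series (fun j => pr P (D j)) @ \oo --> pr P (\bigcup_j D j).
Proof.
move=> mD tD; have mU := bigcupT_measurable D mD.
have : (fun n => \sum_(0 <= j < n) P (D j))%E @ \oo --> P (\bigcup_j D j).
  exact: measure_semi_sigma_additive.
rewrite -prE// => /fine_cvgP[_]; apply: cvg_trans.
apply: near_eq_cvg; near=> n => /=.
rewrite /series/= sum_fine// => j _; exact: fin_num_measure.
Unshelve. all: by end_near. Qed.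

Lemma sum_pr_le (D : nat -> set T) B n :
  (forall j, measurable (D j)) -> trivIset setT D -> measurable B ->
  (forall j, D j `<=` B) -> \sum_(0 <= j < n) pr P (D j) <= pr P B.
Proof.
move=> mD tD mB DB; have mU := bigcupT_measurable D mD.
apply: (@le_trans _ _ (pr P (\bigcup_j D j))); last first.
  by apply: le_pr => // w [j _]; exact: DB.
have cD := cvg_series_pr mD tD; rewrite -(cvg_lim _ cD)//.
apply: (nondecreasing_cvgn_le (u_ := series _)); last by apply/cvg_ex; eexists; exact: cD.
by apply: nondecreasing_series => j _ _; exact: pr_ge0.
Qed.

(** A countable substitute for the union of an arbitrary family of events.  The
    supremum of the probabilities of countable unions of the family is attained,
    since a sequence of countable subfamilies can be merged into one; a member
    that was not almost contained in a union of maximal probability could be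
    added to it. *)
Lemma countable_exhaustion (I : Type) (i0 : I) (U : I -> set T) :
  (forall i, measurable (U i)) ->
  exists a : nat -> I, forall i, P (U i `\` \bigcup_n U (a n)) = 0%E.
Proof.
move=> mU; pose V (a : nat -> I) := \bigcup_n U (a n).
have mV a : measurable (V a) by exact: bigcupT_measurable.
pose E := range (fun a => pr P (V a)).
have supE : has_sup E.
  split; first by exists (pr P (V (fun=> i0))); exists (fun=> i0).
  by exists 1 => _ [a _ <-]; exact: pr_le1.
have aP m : exists a, sup E - m.+1%:R^-1 < pr P (V a).
  have [//|_ [a _ <-] ?] := @sup_adherent _ E m.+1%:R^-1 _ supE.
  by exists a.
have [a {}aP] := choice aP.
(* [b] enumerates the entries of all the sequences [a m]. *)
pose b j := if unpickle j is Some (m, n) then a m n else i0.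
exists b => i; rewrite -/(V b).
have Vab m : V (a m) `<=` V b.
  by move=> w [n _ Uw]; exists (pickle (m, n)) => //; rewrite /b pickleK.
pose c j := if j is j'.+1 then b j' else i.
have Vc : V c = U i `|` V b.
  apply/seteqP; split => [w [[|j] _ Uw]|w [Uw|[j _ Uw]]].
  - by left.
  - by right; exists j.
  - by exists 0%N.
  - by exists j.+1.
have VcD : V c `\` V b = U i `\` V b by rewrite Vc setDUl setDv setU0.
have VcI : V c `&` V b = V b by rewrite Vc setIC setKU.
have mUV : measurable (U i `\` V b) by exact: measurableD.
rewrite -prE//; congr _%:E; apply/eqP; rewrite eq_le pr_ge0 andbT.
have small m : pr P (U i `\` V b) <= m.+1%:R^-1.
  have /(sup_upper_bound supE) : E (pr P (V c)) by exists c.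
  rewrite /= (@prDI (V c) (V b))// VcD VcI => Vcs.
  have := aP m; have := le_pr (mV (a m)) (mV b) (@Vab m).
  by move: Vcs; set u := m.+1%:R^-1; lra.
apply/ler_addgt0Pl => e e0; rewrite addr0.
have [m me] := @ltr_add_invr R 0 e e0.
by rewrite (le_trans (small m))// ltW// -[X in X < _]add0r.
Qed.

End Probability.

(** * Barycenters of sequences in a Banach space *)

(** For weights of sum 1 this is the expectation of a random vector that takes
    the values [v j] with probabilities [p j]. *)
Definition barycenter {R : realType} {V : completeNormedModType R}
  (p : nat -> R) (v : nat -> V) : V := limn (series (fun j => p j *: v j)).

Section Barycenter.
Context {R : realType} {V : completeNormedModType R}.
Implicit Types (p q w : nat -> R) (v : nat -> V) (z : V) (r delta : R).

Lemma norm_lim_series_le w v delta r : 0 <= r ->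
  (forall n, \sum_(0 <= j < n) `|w j| <= delta) ->
  (forall j, w j != 0 -> `|v j| <= r) ->
  cvgn (series (fun j => w j *: v j)) /\
  `|limn (series (fun j => w j *: v j))| <= delta * r.
Proof.
move=> r0 wdelta vr.
have sum_le n : [normed series (fun j => w j *: v j)] n <= delta * r.
  apply: (@le_trans _ _ (\sum_(0 <= j < n) `|w j| * r)).
    rewrite /series/=; apply: ler_sum => j _; rewrite normrZ.
    have [->|wj0] := eqVneq (w j) 0; first by rewrite normr0 !mul0r.
    by rewrite ler_wpM2l// vr.
  by rewrite -mulr_suml ler_wpM2r.
have cn : cvgn [normed series (fun j => w j *: v j)].
  apply: nondecreasing_is_cvgn; last by exists (delta * r) => _ [n _ <-].
  by apply: nondecreasing_series => j _ _; exact: normr_ge0.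
split; first exact: normed_cvg.
apply: (le_trans (lim_series_norm cn)).
by apply: limr_le => //; apply: nearW.
Qed.

Variables (p : nat -> R) (v : nat -> V).
Hypotheses (p0 : forall j, 0 <= p j) (p1 : series p @ \oo --> (1 : R)).

Lemma sum_norm_weights_le1 n : \sum_(0 <= j < n) `|p j| <= 1.
Proof.
rewrite (eq_bigr p); last by move=> j _; rewrite ger0_norm.
rewrite -(cvg_lim _ p1)//; apply: (nondecreasing_cvgn_le (u_ := series p)).
  by apply: nondecreasing_series => j _ _.
by apply/cvg_ex; exists 1.
Qed.

(** Since the weights have sum 1, barycenters commute with translations; the
    recentered series is the one whose convergence can be read off a bound, which
    is only required where the weight does not vanish. *)
Lemma series_recenter z r : 0 <= r -> (forall j, p j != 0 -> `|v j - z| <= r) ->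
  series (fun j => p j *: (v j - z)) @ \oo --> barycenter p v - z.
Proof.
move=> r0 vr.
have [cz _] := norm_lim_series_le r0 sum_norm_weights_le1 vr.
have E : series (fun j => p j *: v j) =
    (fun n => series (fun j => p j *: (v j - z)) n + series p n *: z).
  apply/funext => n; rewrite /series/= scaler_suml -big_split/=.
  by apply: eq_bigr => j _; rewrite scalerBr subrK.
have pz : (fun n => series p n *: z) @ \oo --> z.
  by rewrite -[X in _ --> X]scale1r; exact: cvgZr_tmp.
have cv : (fun n => series (fun j => p j *: (v j - z)) n + series p n *: z) @ \oo
    --> limn (series (fun j => p j *: (v j - z))) + z by exact: cvgD.
rewrite /barycenter E (cvg_lim _ cv)//.
by rewrite addrK.
Qed.

Lemma norm_barycenter_sub_le z r : 0 <= r ->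
  (forall j, p j != 0 -> `|v j - z| <= r) -> `|barycenter p v - z| <= r.
Proof.
move=> r0 vr; rewrite -(cvg_lim _ (series_recenter r0 vr))// -[leRHS]mul1r.
exact: (norm_lim_series_le r0 sum_norm_weights_le1 vr).2.
Qed.

End Barycenter.

(** Recentering both barycenters at the same [z] makes the difference a series
    of total mass [delta] over vectors of norm at most [r]. *)
Lemma norm_barycenterB_le {R : realType} {V : completeNormedModType R}
    (p q : nat -> R) (v : nat -> V) (z : V) (r delta : R) :
  (forall j, 0 <= p j) -> series p @ \oo --> (1 : R) ->
  (forall j, 0 <= q j) -> series q @ \oo --> (1 : R) -> 0 <= r ->
  (forall n, \sum_(0 <= j < n) `|p j - q j| <= delta) ->
  (forall j, p j != 0 -> `|v j - z| <= r) ->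
  (forall j, q j != 0 -> `|v j - z| <= r) ->
  `|barycenter p v - barycenter q v| <= delta * r.
Proof.
move=> p0 p1 q0 q1 r0 pq vp vq.
have cp := series_recenter p0 p1 r0 vp.
have cq := series_recenter q0 q1 r0 vq.
have : (fun n => series (fun j => p j *: (v j - z)) n -
    series (fun j => q j *: (v j - z)) n) @ \oo -->
    (barycenter p v - z) - (barycenter q v - z).
  exact: cvgB cp cq.
rewrite opprB addrA subrK => cpq.
have E : (fun n => series (fun j => p j *: (v j - z)) n -
    series (fun j => q j *: (v j - z)) n) =
    series (fun j => (p j - q j) *: (v j - z)).
  apply/funext => n; rewrite /series/= -sumrB.
  by apply: eq_bigr => j _; rewrite scalerBl.
rewrite -(cvg_lim _ cpq)// [X in lim (X @ _)]E.
apply: (norm_lim_series_le r0 pq _).2 => j pqj.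
have [pj0|/vp//] := eqVneq (p j) 0.
by apply: vq; apply: contra_neq pqj => ->; rewrite pj0 subr0.
Qed.

(** * Distance to a family of points *)

Section DistanceToFamily.
Context {R : realType} {M : metricType R} {I : Type}.
Variables (i0 : I) (g : I -> M).

Definition dist_to (x : M) : R := inf (range (fun i => mdist x (g i))).

Let has_inf_dist x : has_inf (range (fun i => mdist x (g i))).
Proof.
split; first by exists (mdist x (g i0)); exists i0.
by exists 0 => _ [i _ <-]; exact: mdist_ge0.
Qed.

Lemma dist_to_le x i : dist_to x <= mdist x (g i).
Proof. by apply: ge_inf; [exact: (has_inf_dist x).2 | exists i]. Qed.

Lemma dist_to_ltP x r : dist_to x < r -> exists i, mdist x (g i) < r.
Proof.
move=> xr; have e0 : 0 < r - dist_to x by rewrite subr_gt0.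
have [_ [i _ <-] ir] := inf_adherent e0 (has_inf_dist x).
by exists i; rewrite (lt_le_trans ir)// -/(dist_to x) subrKC.
Qed.

Lemma dist_to_ge0 x : 0 <= dist_to x.
Proof.
apply: lb_le_inf; first exact: (has_inf_dist x).1.
by move=> _ [i _ <-]; exact: mdist_ge0.
Qed.

Lemma dist_to_lip x y : dist_to x <= mdist x y + dist_to y.
Proof.
rewrite -lerBlDl; apply: lb_le_inf; first exact: (has_inf_dist y).1.
move=> _ [i _ <-]; rewrite lerBlDl.
exact: le_trans (dist_to_le x i) (metric_triangle _ _ _).
Qed.

End DistanceToFamily.

(** * Clusters of a random partition *)

Section RandomPartition.
Context {R : realType} {M : metricType R} (P : random_partition M).
Implicit Types (x y : M) (w : rp_space P) (k : nat).

Definition separated x y : set (rp_space P) :=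
  [set w | cluster_of w x <> cluster_of w y].

Lemma cluster_ofE w k x : rp_cluster k w x -> cluster_of w x = rp_cluster k w.
Proof.
move=> kx; apply/seteqP; split => [y [l /= lx ly]|y ky]; last by exists k.
suff -> : k = l by [].
by apply: (@rp_disjoint _ _ P w) => //; exists x.
Qed.

Lemma not_separated w x y k :
  ~ separated x y w -> rp_cluster k w x <-> rp_cluster k w y.
Proof.
move=> /contrapT xy.
have mem z : exists2 l, rp_cluster l w z & cluster_of w z = rp_cluster l w.
  have : (\bigcup_k rp_cluster k w) z by rewrite rp_cover.
  by move=> [l _ lz]; exists l => //; exact: cluster_ofE.
split => [kx|ky].
  have [l ly] := mem y; rewrite -xy (cluster_ofE kx) => -> //.
have [l lx] := mem x; rewrite xy (cluster_ofE ky) => -> //.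
Qed.

Lemma measurable_cluster k x : measurable [set w : rp_space P | rp_cluster k w x].
Proof.
have := @rp_measurable _ _ P k _
  (accessible_closed_set1 (hausdorff_accessible (@metric_hausdorff _ M)) (x := x)).
congr measurable; apply/seteqP; split => w /=; first by move=> [_ [->]].
by move=> kx; exists x.
Qed.

Lemma measurable_separated x y : measurable (separated x y).
Proof.
have -> : separated x y =
    \bigcup_k ([set w : rp_space P | rp_cluster k w x] `\`
               [set w : rp_space P | rp_cluster k w y]).
  apply/seteqP; split => w.
    move=> xy; have : (\bigcup_k rp_cluster k w) x by rewrite rp_cover.
    move=> [k _ kx]; exists k => //; split => //= ky.
    by apply: xy; rewrite (cluster_ofE kx) (cluster_ofE ky).
  by move=> [k _ [/= kx ky]]; apply: contrapT => /(@not_separated w x y k)[/(_ kx)].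
by apply: bigcupT_measurable => k; apply: measurableD; exact: measurable_cluster.
Qed.

Lemma mdist_le_diameter Delta w k x y : bounded_partition Delta P ->
  rp_cluster k w x -> rp_cluster k w y -> mdist x y <= Delta.
Proof.
move=> bP kx ky; rewrite -lee_fin; apply: le_trans (bP w k).
by apply: ereal_sup_ubound; exists (x, y).
Qed.

Lemma closed_mdist_le (a : M) (r : R) : closed [set y | mdist a y <= r].
Proof.
move=> y cy /=; apply/ler_addgt0Pl => e e0.
have [z [/= az]] := cy _ (nbhsx_ballx y e e0).
rewrite ballEmdist/= => yz; rewrite (le_trans (metric_triangle _ z _))//.
by rewrite addrC lerD// metric_sym ltW.
Qed.

Definition hits Delta k (a : M) : set (rp_space P) :=
  [set w | [set y | mdist a y <= Delta] `&` rp_cluster k w !=set0].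

(** The pair [ka] captures [x] if the cluster containing [x] is the one with
    index [ka.1] and it meets the closed ball around [ka.2]; given [w], this
    depends on [x] only through its cluster. *)
Definition captured Delta (ka : nat * M) x : set (rp_space P) :=
  [set w : rp_space P | rp_cluster ka.1 w x] `&` hits Delta ka.1 ka.2.

Lemma measurable_captured Delta ka x : measurable (captured Delta ka x).
Proof.
apply: measurableI; first exact: measurable_cluster.
exact/rp_measurable/closed_mdist_le.
Qed.

(** If the [k]-th cluster contains [x], then it meets the ball around [x]; so
    exhausting the events [hits Delta k a] over the centers [a], for every [k],
    exhausts the event that [x] lies in the [k]-th cluster. *)
Lemma capturing_sequence Delta : 0 <= Delta -> M ->
  exists ka : nat -> nat * M,
    forall x, pr (rp_prob P) (\bigcup_j captured Delta (ka j) x) = 1.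
Proof.
move=> D0 x0.
have mH k a : measurable (hits Delta k a).
  exact/rp_measurable/closed_mdist_le.
have [a aP] := choice (fun k => countable_exhaustion (rp_prob P) x0 (mH k)).
pose ka j := if unpickle j is Some (k, n) then (k, a k n) else (0%N, x0).
exists ka => x; set E := \bigcup_j _.
have mE : measurable E by apply: bigcupT_measurable => j; exact: measurable_captured.
suff : rp_prob P (~` E) = 0%E.
  rewrite probability_setC// -(prE (rp_prob P) mE) -EFinB => -[] /eqP.
  by rewrite subr_eq0 => /eqP.
pose N k := hits Delta k x `\` \bigcup_n hits Delta k (a k n).
apply/(negligibleP (rp_prob P) (measurableC mE)).
have nN : (rp_prob P).-negligible (\bigcup_k N k).
  apply: negligible_bigcup => k; apply/negligibleP; last exact: aP.
  by apply: measurableD => //; exact: bigcupT_measurable.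
apply: negligibleS nN.
move=> w Ew.
have : (\bigcup_k rp_cluster k w) x by rewrite rp_cover.
move=> [k _ kx]; exists k => //; split; first by exists x; split; rewrite //= mdistxx.
move=> [n _ hn]; apply: Ew; exists (pickle (k, n)) => //.
by rewrite /ka pickleK.
Qed.

End RandomPartition.

Arguments separated {R M} P x y _.
Arguments captured {R M} P Delta ka x _.

(** * Extension at a single scale *)

Lemma seqDUP {T : Type} (F : nat -> set T) n t :
  seqDU F n t <-> F n t /\ forall i, (i < n)%N -> ~ F i t.
Proof.
rewrite /seqDU -bigcup_mkord; split => -[Fn nF]; split => //.
- by move=> i i_n Fi; apply: nF; exists i.
- by move=> [i /= i_n]; exact: nF.
Qed.

Section SingleScale.
Context {R : realType} {M : metricType R} (P : random_partition M).
Variables (Delta : R) (ka : nat -> nat * M).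
Implicit Types (x y : M) (j : nat).

Definition first_captured x j : set (rp_space P) :=
  seqDU (fun j => captured P Delta (ka j) x) j.

Definition weight x j : R := pr (rp_prob P) (first_captured x j).

Lemma measurable_first_captured x j : measurable (first_captured x j).
Proof. by apply: seqDU_measurable => i; exact: measurable_captured. Qed.

Lemma weight_ge0 x j : 0 <= weight x j.
Proof. exact: pr_ge0. Qed.

Lemma sum_weight x :
  pr (rp_prob P) (\bigcup_j captured P Delta (ka j) x) = 1 ->
  series (weight x) @ \oo --> (1 : R).
Proof.
move=> <-; rewrite seqDU_bigcup_eq; apply: cvg_series_pr; last exact: trivIset_seqDU.
exact: measurable_first_captured.
Qed.

Lemma weight_neq0 x j : bounded_partition Delta P -> weight x j != 0 ->
  mdist x (ka j).2 <= 2 * Delta.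
Proof.
move=> bP wj; have [w] : first_captured x j !=set0.
  apply/set0P; apply: contra_neq wj => E0.
  by rewrite /weight E0 /pr measure0.
move=> /(@subset_seqDU _ _ _ w)[/= kx [y [/= ay ky]]].
have := mdist_le_diameter bP kx ky; have := metric_triangle x y (ka j).2.
rewrite (metric_sym y); lra.
Qed.

Lemma first_captured_not_separated x y j :
  first_captured x j `\` separated P x y = first_captured y j `\` separated P x y.
Proof.
have swap i w : ~ separated P x y w ->
    captured P Delta (ka i) x w <-> captured P Delta (ka i) y w.
  move=> /(not_separated (ka i).1) kxy; rewrite /captured/=; split => -[].
  - by move=> /kxy.
  - by move=> /kxy.
by apply/seteqP; split => w [/seqDUP[Cj nC] nS]; split => //; apply/seqDUP;
  (split; first exact/(swap _ _ nS)) => i /nC; apply: contra_not => /(swap _ _ nS).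
Qed.

(** Off the event that [x] and [y] are separated, both are captured at the same
    step, so that the difference of the weights at step [j] comes from the parts
    of two events inside [separated P x y].  Each of the two families is
    disjoint, which bounds the sum over [j]. *)
Lemma sum_norm_weightB x y n :
  \sum_(0 <= j < n) `|weight x j - weight y j| <=
  2 * pr (rp_prob P) (separated P x y).
Proof.
set S := separated P x y; have mS : measurable S by exact: measurable_separated.
have mF := measurable_first_captured.
have part z : \sum_(0 <= j < n) pr (rp_prob P) (first_captured z j `&` S) <=
    pr (rp_prob P) S.
  apply: sum_pr_le => // [j|]; first exact: measurableI.
  exact/trivIset_setIr/trivIset_seqDU.
apply: le_trans (_ : \sum_(0 <= j < n)
   (pr (rp_prob P) (first_captured x j `&` S) +
    pr (rp_prob P) (first_captured y j `&` S)) <= _); last first.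
  by rewrite big_split/= mulr_natl mulr2n lerD.
apply: ler_sum => j _; rewrite /weight.
rewrite (prDI (rp_prob P) (mF x j) mS) (prDI (rp_prob P) (mF y j) mS).
rewrite first_captured_not_separated opprD addrACA subrr add0r.
by apply: (le_trans (ler_normB _ _)); rewrite !ger0_norm// pr_ge0.
Qed.

End SingleScale.

(** The value at [x] is the barycenter of the values of [f] at points [g (c j)]
    nearly nearest to the centers that may capture [x].  Such a center lies within
    [2 Delta] of [x], hence [g (c j)] within [2 * r + 5 * Delta] of every [g i]
    with [mdist x (g i) <= r]. *)
Lemma single_scale_extension {R : realType} {M : metricType R}
    (P : random_partition M) (Delta : R) {I : Type} (i0 : I) (g : I -> M)
    (Z : completeNormedModType R) (f : I -> Z) :
  0 < Delta -> bounded_partition Delta P ->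
  (forall i j, `|f i - f j| <= mdist (g i) (g j)) ->
  exists G : M -> Z,
    (forall x i, `|G x - f i| <= 2 * mdist x (g i) + 5 * Delta) /\
    (forall x y i r, mdist x (g i) <= r -> mdist y (g i) <= r ->
      `|G x - G y| <=
      2 * pr (rp_prob P) (separated P x y) * (2 * r + 5 * Delta)).
Proof.
move=> D0 bP fL.
have [ka kaP] := capturing_sequence P (ltW D0) (g i0).
have nearest j : exists k, forall i,
    mdist (ka j).2 (g k) <= mdist (ka j).2 (g i) + Delta.
  have : dist_to g (ka j).2 < dist_to g (ka j).2 + Delta by rewrite ltrDl.
  move=> /(dist_to_ltP i0)[k kD]; exists k => i; apply: le_trans (ltW kD) _.
  by rewrite lerD2r dist_to_le.
have [c cP] := choice nearest.
have near x i r j : mdist x (g i) <= r -> weight P Delta ka x j != 0 ->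
    `|f (c j) - f i| <= 2 * r + 5 * Delta.
  move=> xr /(weight_neq0 bP) xa; apply: le_trans (fL _ _) _.
  have := cP j i; have := metric_triangle (g (c j)) (ka j).2 (g i).
  have := metric_triangle (ka j).2 x (g i).
  rewrite (metric_sym (g (c j)) (ka j).2) (metric_sym (ka j).2 x); lra.
have r0 x i r : mdist x (g i) <= r -> 0 <= 2 * r + 5 * Delta.
  by have := mdist_ge0 x (g i); lra.
exists (fun x => barycenter (weight P Delta ka x) (f \o c)); split.
  move=> x i; apply: norm_barycenter_sub_le.
  - by move=> j; exact: weight_ge0.
  - exact/sum_weight/kaP.
  - exact: (r0 x i).
  - by move=> j; exact: (near x i).
move=> x y i r xr yr; apply: (@norm_barycenterB_le _ _ _ _ _ (f i)).
- by move=> j; exact: weight_ge0.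
- exact/sum_weight/kaP.
- by move=> j; exact: weight_ge0.
- exact/sum_weight/kaP.
- exact: (r0 x i).
- exact: sum_norm_weightB.
- by move=> j; exact: (near x i).
- by move=> j; exact: (near y i).
Qed.

(** * Interpolation between dyadic scales *)

Section DyadicInterpolation.
Context {R : realType} {V : normedModType R}.
Implicit Types (s t a e : R) (h : R -> V).

Let ln2_gt0 : 0 < ln (2 : R). Proof. by rewrite ln_gt0// ltr1n. Qed.

(** For [t > 0], the largest [2 ^ n] with [n] an integer and [2 ^ n <= t]. *)
Definition dyadic_floor t : R := expR ((Num.floor (ln t / ln 2))%:~R * ln 2).

Let expR_succ (n : int) :
  expR ((n + 1)%:~R * ln 2) = 2 * expR (n%:~R * ln 2) :> R.
Proof.
have -> : (n + 1)%:~R * ln 2 = ln 2 + n%:~R * ln 2 :> R by rewrite intrD; ring.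
by rewrite expRD lnK ?posrE.
Qed.

Lemma dyadic_floor_gt0 t : 0 < dyadic_floor t.
Proof. exact: expR_gt0. Qed.

Lemma dyadic_floor_itv t : 0 < t -> dyadic_floor t <= t < 2 * dyadic_floor t.
Proof.
move=> t0; rewrite /dyadic_floor; set n := Num.floor _.
have /andP[nl nu] := floor_itv (ln t / ln 2).
rewrite -expR_succ -(lnK t0) ler_expR ltr_expR.
by rewrite -ler_pdivlMr// nl -ltr_pdivrMr.
Qed.

Lemma dyadic_floor_doubling s t : 0 < t -> t <= s < 2 * t ->
  dyadic_floor s = dyadic_floor t \/ dyadic_floor s = 2 * dyadic_floor t.
Proof.
move=> t0 /andP[ts st]; have s0 : 0 < s := lt_le_trans t0 ts.
have : (Num.floor (ln t / ln 2) <= Num.floor (ln s / ln 2))%R.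
  by apply: le_floor; rewrite ler_pM2r ?invr_gt0// ler_ln.
have : (Num.floor (ln s / ln 2) <= Num.floor (ln t / ln 2) + 1)%R.
  have /andP[nl _] := floor_itv (ln s / ln 2).
  have /andP[_ nu] := floor_itv (ln t / ln 2).
  rewrite -ltzD1 -(ltr_int R); apply: (le_lt_trans nl).
  rewrite intrD; apply: le_lt_trans (_ : ln t / ln 2 + 1 < _); last by rewrite ltrD2r.
  rewrite -[X in _ + X](@divff _ (ln 2)) ?gt_eqF// -mulrDl ler_pM2r ?invr_gt0//.
  by rewrite addrC -lnM ?posrE// ler_ln ?posrE ?mulr_gt0// ltW.
rewrite /dyadic_floor; set n := Num.floor _; set m := Num.floor _ => nm mn.
have [->|->] : n = m \/ n = m + 1 by lia.
  by left.
by right; rewrite expR_succ.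
Qed.

(** The affine function through [(a, h a)] and [(2 * a, h (2 * a))], evaluated at
    [t]. *)
Definition interpolate h a t : V := (2 - t / a) *: h a + (t / a - 1) *: h (2 * a).

Lemma norm_convex_le (u v : V) (al be e : R) : 0 <= al -> 0 <= be -> al + be = 1 ->
  `|u| <= e -> `|v| <= e -> `|al *: u + be *: v| <= e.
Proof.
move=> al0 be0 ab ue ve; apply: (le_trans (ler_normD _ _)).
rewrite !normrZ !ger0_norm// -[leRHS]mul1r -ab mulrDl.
by rewrite lerD// ler_wpM2l.
Qed.

Let coef_ge0 a t : 0 < a -> a <= t < 2 * a -> 0 <= 2 - t / a /\ 0 <= t / a - 1.
Proof.
move=> a0 /andP[at_ ta]; rewrite !subr_ge0 ler_pdivrMr// ler_pdivlMr// mul1r.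
by rewrite ltW.
Qed.

Lemma interpolate_sub_le h z a t e : 0 < a -> a <= t < 2 * a ->
  `|h a - z| <= e -> `|h (2 * a) - z| <= e -> `|interpolate h a t - z| <= e.
Proof.
move=> a0 ta ha h2a; have [c0 c1] := coef_ge0 a0 ta.
have -> : interpolate h a t - z =
    (2 - t / a) *: (h a - z) + (t / a - 1) *: (h (2 * a) - z).
  rewrite /interpolate !scalerBr addrACA -opprD -scalerDl.
  have -> : 2 - t / a + (t / a - 1) = 1 by ring.
  by rewrite scale1r.
by apply: norm_convex_le => //; ring.
Qed.

Lemma interpolateB_le h k a t e : 0 < a -> a <= t < 2 * a ->
  `|h a - k a| <= e -> `|h (2 * a) - k (2 * a)| <= e ->
  `|interpolate h a t - interpolate k a t| <= e.
Proof.
move=> a0 ta ha h2a; have [c0 c1] := coef_ge0 a0 ta.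
rewrite /interpolate opprD addrACA -!scalerBr.
by apply: norm_convex_le => //; ring.
Qed.

Let mix (al be : R) (u v w : V) :
  (1 - al) *: v + al *: u - (be *: w + (1 - be) *: v) =
  al *: (u - v) + be *: (v - w).
Proof.
rewrite !scalerBl !scalerBr !scale1r opprD opprB.
have -> : v - al *: v + al *: u = al *: u - al *: v + v by rewrite addrC addrCA addrC.
by rewrite addrCA -(addrA (_ - _)) subrKC addrC -addrA.
Qed.

(** The slope on the dyadic interval starting at [c] is the difference of [h]
    between [c] and [2 * c], divided by [c]; going through [z] this is at most
    [(4 * e + 15 * c) / c], and [e <= 4 * c] on the intervals concerned.  As
    [s < 2 * t], the segment from [t] to [s] crosses at most one power of 2. *)
Lemma interpolate_lip h z e s t :
  (forall a, 0 < a -> `|h a - z| <= 2 * e + 5 * a) ->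
  0 < t -> t <= s < 2 * t -> e <= 2 * t ->
  `|interpolate h (dyadic_floor s) s - interpolate h (dyadic_floor t) t|
    <= 31 * (s - t).
Proof.
move=> hz t0 /[dup] ts /andP[t_s _] et.
have /andP[at_ ta] := dyadic_floor_itv t0.
have /andP[bs sb] := dyadic_floor_itv (lt_le_trans t0 t_s).
have := dyadic_floor_doubling t0 ts.
have := dyadic_floor_gt0 t.
move: bs sb at_ ta; set a := dyadic_floor t; set b := dyadic_floor s => bs sb at_ ta a0.
have step c : a <= c -> `|h (2 * c) - h c| <= 31 * c.
  move=> ac; have c0 : 0 < c by exact: lt_le_trans ac.
  have := ler_distD z (h (2 * c)) (h c); rewrite (distrC z).
  have := hz c c0; have := hz (2 * c) ltac:(by rewrite mulr_gt0).
  by lra.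
case=> ba.
  (* [s] and [t] lie in the same dyadic interval. *)
  have -> : interpolate h b s - interpolate h a t =
      ((s - t) / a) *: (h (2 * a) - h a).
    rewrite ba /interpolate opprD addrACA -!scalerBl scalerBr addrC -scaleNr.
    by congr (_ *: _ + _ *: _); field; rewrite gt_eqF.
  rewrite normrZ ger0_norm; last by rewrite divr_ge0 ?subr_ge0// ltW.
  apply: (@le_trans _ _ ((s - t) / a * (31 * a))).
    by rewrite ler_wpM2l ?step// divr_ge0 ?subr_ge0// ltW.
  by rewrite le_eqVlt; apply/orP; left; apply/eqP; field; rewrite gt_eqF.
(* They lie in adjacent intervals, which meet at [2 * a]. *)
rewrite ba in bs sb *.
have -> : interpolate h (2 * a) s - interpolate h a t =
    ((s - 2 * a) / (2 * a)) *: (h (2 * (2 * a)) - h (2 * a)) +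
    ((2 * a - t) / a) *: (h (2 * a) - h a).
  rewrite /interpolate; set u := h (2 * (2 * a)); set v := h (2 * a); set w := h a.
  have -> : (s - 2 * a) / (2 * a) = s / (2 * a) - 1 by field; rewrite gt_eqF.
  have -> : (2 * a - t) / a = 2 - t / a by field; rewrite gt_eqF.
  set al := s / _ - 1; set be := 2 - t / a.
  have -> : 2 - s / (2 * a) = 1 - al by rewrite /al; ring.
  have -> : t / a - 1 = 1 - be by rewrite /be; ring.
  exact: mix.
have c1 : 0 <= (s - 2 * a) / (2 * a) by rewrite divr_ge0 ?subr_ge0 ?mulr_ge0// ltW.
have c2 : 0 <= (2 * a - t) / a by rewrite divr_ge0 ?subr_ge0// ltW.
apply: (le_trans (ler_normD _ _)).
rewrite (normrZ ((s - 2 * a) / (2 * a))) (normrZ ((2 * a - t) / a)).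
rewrite (ger0_norm c1) (ger0_norm c2).
apply: (@le_trans _ _ ((s - 2 * a) / (2 * a) * (31 * (2 * a)) +
                       (2 * a - t) / a * (31 * a))).
  by rewrite lerD// ler_wpM2l ?step//; lra.
by rewrite le_eqVlt; apply/orP; left; apply/eqP; field; rewrite gt_eqF.
Qed.

End DyadicInterpolation.

(** * Gluing the scales *)

(** A point at distance 0 from the domain is a limit of points of the domain, along
    which the values of the Lipschitz map form a Cauchy sequence. *)
Lemma closure_value {R : realType} {M : metricType R} {I : Type} (i0 : I)
    (g : I -> M) (Z : completeNormedModType R) (f : I -> Z) (x : M) :
  (forall i j, `|f i - f j| <= mdist (g i) (g j)) -> dist_to g x = 0 ->
  exists z, forall i, `|z - f i| <= mdist x (g i).
Proof.
move=> fL dx.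
have approx (n : nat) : exists i, mdist x (g i) < n.+1%:R^-1.
  by apply: (dist_to_ltP i0); rewrite dx invr_gt0.
have [c cP] := choice approx.
have small (e : R) : 0 < e -> exists N, forall n, (N <= n)%N -> mdist x (g (c n)) < e.
  move=> e0; have [N Ne] := @ltr_add_invr R 0 e e0; exists N => n Nn.
  apply: (lt_le_trans (cP n)); rewrite ltW// (le_lt_trans _ Ne)// add0r.
  by rewrite lef_pV2 ?posrE// ler_nat.
have cvg_fc : cvg ((f \o c) @ \oo).
  apply/cauchy_cvgP/cauchy_exP => e e0.
  have [N NP] := small (e / 2) (divr_gt0 e0 (ltr0Sn _ 1)).
  exists (f (c N)); exists N => // n /= Nn.
  rewrite -ball_normE/=; apply: (le_lt_trans (fL _ _)).
  have := metric_triangle (g (c N)) x (g (c n)); rewrite (metric_sym _ x).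
  by have := NP N (leqnn _); have := NP n Nn; lra.
exists (lim ((f \o c) @ \oo)) => i; apply/ler_addgt0Pl => e e0.
have e20 : 0 < e / 2 by rewrite divr_gt0.
have [N NP] := small _ e20.
have [N' _ N'P] := (cvgrPdist_lt _ _).1 cvg_fc _ e20.
have := N'P (maxn N N') (leq_maxr _ _); have := NP (maxn N N') (leq_maxl _ _).
set n := maxn N N' => xn fn.
have := ler_distD (f (c n)) (lim ((f \o c) @ \oo)) (f i).
have := fL (c n) i; have := metric_triangle (g (c n)) x (g i).
rewrite (metric_sym (g (c n)) x); move: fn => /=; lra.
Qed.

Section Gluing.
Context {R : realType} {M : metricType R} {I : Type}.
Variables (i0 : I) (g : I -> M) (Z : completeNormedModType R) (f : I -> Z).
Variables (sep : M -> M -> R) (G : R -> M -> Z).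
Hypothesis f_lip : forall i j, `|f i - f j| <= mdist (g i) (g j).
Hypothesis sep_sym : forall x y, sep x y = sep y x.
Hypothesis mdist_sep : forall x y, mdist x y <= sep x y.
Hypothesis G_near : forall a x i, 0 < a ->
  `|G a x - f i| <= 2 * mdist x (g i) + 5 * a.
Hypothesis G_sep : forall a x y i r, 0 < a ->
  mdist x (g i) <= r -> mdist y (g i) <= r ->
  a * `|G a x - G a y| <= 2 * sep x y * (2 * r + 5 * a).

Let D := dist_to g.
Let H (x : M) (t : R) := interpolate (fun a => G a x) (dyadic_floor t) t.

(* Both scales used by [H x (D x)] are at most [2 * D x <= 2 * mdist x (g i)],
   and [2 + 5 * 2 = 12]. *)
Let H_near x i : 0 < D x -> `|H x (D x) - f i| <= 12 * mdist x (g i).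
Proof.
move=> Dx; have := dist_to_le i0 g x i; rewrite -/D => Dxi.
have /andP[aD Da] := dyadic_floor_itv Dx; have a0 := dyadic_floor_gt0 (D x).
apply: interpolate_sub_le => //; first by rewrite aD.
- by have := G_near x i a0; lra.
- by have := @G_near (2 * dyadic_floor (D x)) x i ltac:(lra); lra.
Qed.

(* Near [x] and [y] the functions [G a] vary by at most [28 * sep x y], and the
   change of the interpolation parameter costs [31 * (D x - D y)]. *)
Let H_sep x y : D y <= D x -> 4 * mdist x y < D x ->
  `|H x (D x) - H y (D y)| <= 59 * sep x y.
Proof.
move=> Dyx xDx; have xy0 := mdist_ge0 x y; have xys := mdist_sep x y.
have Dx : 0 < D x by lra.
have DxDy := dist_to_lip i0 g x y; rewrite -/D in DxDy.
have Dy : 0 < D y by lra.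
have [i yi] : exists i, mdist y (g i) < 2 * D y.
  by apply: (dist_to_ltP i0); rewrite -/D; lra.
have xi := metric_triangle x y (g i).
have /andP[aD Da] := dyadic_floor_itv Dx; have a0 := dyadic_floor_gt0 (D x).
have Hx : `|H x (D x) - H y (D x)| <= 28 * sep x y.
  (* [x] and [y] are within [9 / 4 * D x < 9 / 2 * b] of [g i]. *)
  have bnd b : dyadic_floor (D x) <= b -> `|G b x - G b y| <= 28 * sep x y.
    move=> ab; have b0 : 0 < b by lra.
    have Gb := @G_sep b x y i (9 / 4 * D x) b0 ltac:(lra) ltac:(lra).
    rewrite -(ler_pM2l b0); apply: (le_trans Gb).
    have -> : b * (28 * sep x y) = 2 * sep x y * (14 * b) by ring.
    by rewrite ler_wpM2l; lra.
  apply: interpolateB_le => //; first by rewrite aD.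
  - exact: bnd.
  - by apply: bnd; lra.
have Hy : `|H y (D x) - H y (D y)| <= 31 * (D x - D y).
  apply: (@interpolate_lip _ _ _ (f i) (mdist y (g i))) => //.
  - by move=> a; exact: G_near.
  - by rewrite Dyx/=; lra.
  - by lra.
have := ler_distD (H y (D x)) (H x (D x)) (H y (D y)); lra.
Qed.

(** If [4 * mdist x y < D x], the bound is [H_sep].  Otherwise, for [x != y], some
    [g i] lies within [5 * mdist x y] of [x], hence within [6 * mdist x y] of [y],
    and comparing both values with [f i] gives the constant [12 * (5 + 6) = 132]. *)
Lemma glue_scales : exists F : M -> Z,
  (forall i, F (g i) = f i) /\ (forall x y, `|F x - F y| <= 132 * sep x y).
Proof.
(* The bound with the constant 12 already forces the value [f i] at [g i]. *)
have FP x : exists z, (forall i, `|z - f i| <= 12 * mdist x (g i)) /\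
    (0 < D x -> z = H x (D x)).
  have [Dx|Dx] := ltP 0 (D x).
    by exists (H x (D x)); split => // i; exact: H_near.
  have /(closure_value i0 f_lip)[z zP] : D x = 0.
    by apply/eqP; rewrite eq_le Dx dist_to_ge0.
  exists z; split => // i; apply: (le_trans (zP i)).
  by have := mdist_ge0 x (g i); lra.
have [F {}FP] := choice FP.
exists F; split => [i|].
  apply/eqP; rewrite -subr_eq0 -normr_le0; have [/(_ i) + _] := FP (g i).
  by rewrite mdistxx mulr0.
suff main x y : D y <= D x -> `|F x - F y| <= 132 * sep x y.
  move=> x y; have [Dyx|/ltW Dxy] := leP (D y) (D x); first exact: main.
  by rewrite distrC sep_sym; exact: main.
move=> Dyx; have xys := mdist_sep x y.
have [xDx|Dx_xy] := ltP (4 * mdist x y) (D x).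
  have xy0 := mdist_ge0 x y; have DxDy := dist_to_lip i0 g x y; rewrite -/D in DxDy.
  rewrite (FP x).2 ?(FP y).2; try lra.
  by have := H_sep Dyx xDx; lra.
have [->|] := eqVneq x y.
  rewrite subrr normr0 mulr_ge0//; exact: le_trans (mdist_ge0 y y) (mdist_sep y y).
rewrite -mdist_gt0 => xy0.
have [i xi] : exists i, mdist x (g i) < 5 * mdist x y.
  by apply: (dist_to_ltP i0); rewrite -/D; lra.
have yi := metric_triangle y x (g i); rewrite (metric_sym y x) in yi.
have := ler_distD (f i) (F x) (F y); rewrite (distrC (f i)).
by have := (FP x).1 i; have := (FP y).1 i; lra.
Qed.

End Gluing.

(** If [sep x y < mdist x y], then [x] and [y] are separated with probability 1 at
    any scale strictly between the two numbers, such as their mean. *)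
Lemma mdist_le_separation {R : realType} {M : metricType R} (sep : M -> M -> R) :
  separation_profile sep -> forall x y, mdist x y <= sep x y.
Proof.
move=> [[sep0 _ _ _] [P [bP sepP]]] x y.
rewrite leNgt; apply/negP => xy.
have d0 : 0 < (sep x y + mdist x y) / 2.
  by have := sep0 x y; lra.
pose Delta := PosNum d0.
have sepT : separated (P Delta) x y = setT.
  apply/seteqP; split => // w _; apply: contrapT => nS.
  have : (\bigcup_k rp_cluster k w) x by rewrite rp_cover.
  move=> [k _ kx]; have ky := (not_separated k nS).1 kx.
  by have := mdist_le_diameter (bP Delta) kx ky; rewrite /=; lra.
have : ((Delta%:num)%:E * separation_prob (P Delta) x y <= (sep x y)%:E)%E.
  by apply: le_trans (sepP x y); apply: ereal_sup_ubound; exists Delta.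
have -> : separation_prob (P Delta) x y = 1%E.
  by rewrite /separation_prob -/(separated (P Delta) x y) sepT probability_setT.
by rewrite mule1 lee_fin /=; lra.
Qed.

(** * The extension theorem *)

Unset Implicit Arguments.

Theorem theorem66 (R : realType) :
  exists C : R, 0 < C /\
  forall (M : metricType R) (sep : M -> M -> R),
    locally_compact [set: M] ->
    separation_profile sep ->
    forall (Z : completeNormedModType R) (S : set M) (f : set_type S -> Z),
      (forall x y : set_type S, `|f x - f y| <= mdist (val x) (val y)) ->
      exists F : M -> Z,
        (forall x : set_type S, F (val x) = f x) /\
        (forall x y : M, `|F x - F y| <= C * sep x y).
Proof.
exists 132; split=> // M sep _ sepP Z S f f_lip.
have [[sep0 _ sepC _] [P [bP PS]]] := sepP.
have [[c _]|noS] := pselect (exists c : set_type S, True); last first.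
  exists (fun=> 0); split => [c|x y]; first by exfalso; apply: noS; exists c.
  by rewrite subrr normr0 mulr_ge0.
have prD (a : {posnum R}) x y :
    a%:num * pr (rp_prob (P a)) (separated (P a) x y) <= sep x y.
  rewrite -lee_fin EFinM prE; last exact: measurable_separated.
  by apply: le_trans (PS x y); apply: ereal_sup_ubound; exists a.
(* Multiplying by the scale turns the separation probability into [sep x y]. *)
have GP (a : R) : exists G : M -> Z, 0 < a ->
    (forall x (i : set_type S), `|G x - f i| <= 2 * mdist x (val i) + 5 * a) /\
    (forall x y (i : set_type S) r,
      mdist x (val i) <= r -> mdist y (val i) <= r ->
      a * `|G x - G y| <= 2 * sep x y * (2 * r + 5 * a)).
  have [a0|a0] := ltP 0 a; last by exists (fun=> 0).
  have [G [Gf GG]] := single_scale_extension c a0 (bP (PosNum a0)) f_lip.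
  exists G => _; split => // x y i r xr yr.
  apply: (le_trans (ler_wpM2l (ltW a0) (GG x y i r xr yr))).
  rewrite mulrA ler_wpM2r//; first by have := mdist_ge0 x (val i); lra.
  by have := prD (PosNum a0) x y; rewrite /=; lra.
have [G {}GP] := choice GP.
apply: (@glue_scales _ _ _ c val _ f sep G) => //.
- exact: mdist_le_separation.
- by move=> a x i a0; exact: (GP a a0).1.
- by move=> a x y i r a0; exact: (GP a a0).2.
Qed.
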